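(* Let $A$ be a finite-dimensional unimodular ribbon Hopf algebra over a field $k$. The linear map $\delta:Z(A)\otimes Z(A)\to C^2_Z$, $\delta(w,z)=z\otimes w-(1\otimes w)\Delta(z)$, factors through a well-defined map $\hat\delta:\hat Z(A)\otimes\hat Z(A)\to C^2_Z/K^2_Z$.
   Context: $A=(A,m,\Delta,S,\epsilon,e)$ is a finite-dimensional Hopf algebra over a field $k$. It is quasitriangular with $R$-matrix $R=\sum_i\alpha_i\otimes\beta_i$ (invertible, $T\Delta(a)=R\Delta(a)R^{-1}$ with $T$ the flip, $(\Delta\otimes1)R=R^{13}R^{23}$, $(1\otimes\Delta)R=R^{13}R^{12}$). Ribbon: $A$ is endowed with an invertible group-like element $g$ ($\Delta(g)=g\otimes g$) such that $S^2(a)=gag^{-1}$ for all $a$, and, with $u=\sum_i S(\beta_i)\alpha_i$, the central ribbon element $\theta=gu^{-1}=u^{-1}g$ satisfies $S(\theta)=\theta$. Unimodular: left and right integrals of $A$ coincide. $\Lambda\in A$ is an integral ($a\Lambda=\Lambda a=\epsilon(a)\Lambda$) and $\lambda\in A^*$ is a right integral for $A^*$ ($\sum\lambda(a_{(1)})a_{(2)}=\lambda(a)1$), with $\lambda(\Lambda)=1$. $Z(A)$ is the center; $K(A)=\{a\in Z(A)\mid\lambda(ab)=0\text{ for all }b\in Z(A)\}$; $\hat Z(A)=Z(A)/K(A)$. $C^2=\{x\in A\otimes A\mid \Delta(b)x=x\Delta(b)\text{ for all }b\in A\}$. $C^2_Z\subset C^2$ is the commutative subalgebra generated by the elements $(a\otimes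 b)\Delta(c)$ with $a,b,c\in Z(A)$. $\mu:C^2_Z\otimes C^2\to k$ is $\mu(\sum_i a_i\otimes b_i,\sum_j c_j\otimes d_j)=\sum_{i,j}\lambda(a_ic_j)\lambda(b_id_j)$, and $K^2_Z=\{x\in C^2_Z\mid\mu(x,y)=0\text{ for all }y\in C^2\}$. *)

(* Defs.v *)
From HB Require Import structures.
From mathcomp Require Import all_boot all_order all_algebra all_field.

Set Implicit Arguments.
Unset Strict Implicit.
Unset Printing Implicit Defensive.

Import GRing.Theory.
Local Open Scope ring_scope.

(* The tensor product of two finite-dimensional spaces is the space of        *)
(* coordinate matrices on the products of the library bases of the factors;   *)
(* tliftE and tensor_homP below are its universal property.                   *)
Section Tensor.

Variables (k : fieldType) (V W : vectType k).

Definition tensor : Type := 'M[k]_(\dim {:V}, \dim {:W}).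

HB.instance Definition _ := Vector.copy tensor 'M[k]_(\dim {:V}, \dim {:W}).

Definition tens (v : V) (w : W) : tensor :=
  \matrix_(i, j) (coord (vbasis {:V}) i v * coord (vbasis {:W}) j w).

(* The linear map sending v (x) w to f v w, for a bilinear f. *)
Definition tlift (U : vectType k) (f : V -> W -> U) : 'Hom(tensor, U) :=
  linfun (fun t : tensor =>
    \sum_i \sum_j (t : 'M_(_, _)) i j *: f (vbasis {:V})`_i (vbasis {:W})`_j).

Lemma tlift_sumE (U : vectType k) (f : V -> W -> U) (t : tensor) :
  tlift f t = \sum_i \sum_j (t : 'M_(_, _)) i j *:
                 f (vbasis {:V})`_i (vbasis {:W})`_j.
Proof.
rewrite /tlift; set g := fun t : tensor => _.
have lg : linear g.
  move=> a s u; rewrite /g scaler_sumr -big_split /=; apply: eq_bigr => i _.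
  rewrite scaler_sumr -big_split /=; apply: eq_bigr => j _.
  by rewrite !mxE scalerDl scalerA.
pose G := GRing.isLinear.Build k tensor U *:%R g lg.
pose g' : {linear tensor -> U} := HB.pack g G.
exact: (lfunE g').
Qed.

Lemma tens_linearl w : linear (tens^~ w).
Proof.
by move=> a v v'; apply/matrixP => i j; rewrite !mxE linearP /= mulrDl -mulrA.
Qed.

Lemma tens_linearr v : linear (tens v).
Proof.
move=> a w w'; apply/matrixP => i j.
by rewrite !mxE linearP /= mulrDr mulrCA.
Qed.

Lemma tliftE (U : vectType k) (f : V -> W -> U) :
  (forall w, linear (f^~ w)) -> (forall v, linear (f v)) ->
  forall v w, tlift f (tens v w) = f v w.
Proof.
move=> fl fr v w; rewrite tlift_sumE.
pose Fl w := GRing.isLinear.Build k V U *:%R (f^~ w) (fl w).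
pose fl' w : {linear V -> U} := HB.pack (f^~ w) (Fl w).
pose Fr v := GRing.isLinear.Build k W U *:%R (f v) (fr v).
pose fr' v : {linear W -> U} := HB.pack (f v) (Fr v).
rewrite {2}(coord_vbasis (memvf v)) -[RHS]/(fl' w _) linear_sum /=.
apply: eq_bigr => i _; rewrite -[f (_ *: _) _]/(fl' w _) linearZ /=.
rewrite {2}(coord_vbasis (memvf w)) -[f _ (\sum_i _)]/(fr' _ _) linear_sum /=.
rewrite scaler_sumr; apply: eq_bigr => j _.
by rewrite -[f _ (_ *: _)]/(fr' _ _) linearZ /= mxE scalerA.
Qed.

Lemma tensor_decomp (t : tensor) :
  t = \sum_i \sum_j (t : 'M_(_, _)) i j *:
        tens (vbasis {:V})`_i (vbasis {:W})`_j.
Proof.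
apply/matrixP => a b; rewrite summxE (bigD1 a) //= summxE (bigD1 b) //=.
have cE (X : vectType k) (i j : 'I_(\dim {:X})) :
    coord (vbasis {:X}) i (vbasis {:X})`_j = (j == i)%:R.
  by rewrite coord_free ?(basis_free (vbasisP _)).
rewrite mxE mxE !cE !eqxx !mulr1 big1 ?addr0 => [|j nj]; last first.
  by rewrite !mxE !cE (negPf nj) !mulr0.
rewrite big1 ?addr0 // => i ni; rewrite summxE big1 // => j _.
by rewrite !mxE !cE (negPf ni) mul0r mulr0.
Qed.

Lemma tensor_homP (U : vectType k) (f g : 'Hom(tensor, U)) :
  (forall v w, f (tens v w) = g (tens v w)) -> f = g.
Proof.
move=> fg; apply/lfunP => t; rewrite [t]tensor_decomp !linear_sum /=.
apply: eq_bigr => i _; rewrite !linear_sum; apply: eq_bigr => j _.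
by rewrite !linearZ /= fg.
Qed.

End Tensor.

Notation "v ⊗ w" := (tens v w) (at level 38, left associativity).

Section TensorMaps.

Variable k : fieldType.

Definition tmap (V W V' W' : vectType k) (f : 'Hom(V, V')) (g : 'Hom(W, W')) :
  'Hom(tensor V W, tensor V' W') := tlift (fun v w => f v ⊗ g w).

Lemma tmapE (V W V' W' : vectType k) (f : 'Hom(V, V')) (g : 'Hom(W, W')) v w :
  tmap f g (v ⊗ w) = f v ⊗ g w.
Proof.
rewrite /tmap tliftE // => [{}w|{}v] a x y.
  by rewrite linearP /= tens_linearl.
by rewrite linearP /= tens_linearr.
Qed.

Definition tassoc (V W U : vectType k) :
  'Hom(tensor (tensor V W) U, tensor V (tensor W U)) :=
  tlift (fun t u => tlift (fun v w => v ⊗ (w ⊗ u)) t).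

Definition tflip (V W : vectType k) : 'Hom(tensor V W, tensor W V) :=
  tlift (fun v w => w ⊗ v).

End TensorMaps.

(* The algebra A (x) B, with (a (x) b) (c (x) d) = ac (x) bd. *)
Section TensorAlgebra.

Variables (k : fieldType) (A B : falgType k).
Local Notation AB := (tensor A B).

Definition tmul (s t : AB) : AB :=
  tlift (fun a b => tlift (fun c d => (a * c) ⊗ (b * d)) t) s.

Definition tone : AB := 1 ⊗ 1.

Let inner_l a b (t : AB) := tlift (fun c d => (a * c) ⊗ (b * d)) t.

Let inner_lE a b c d : inner_l a b (c ⊗ d) = (a * c) ⊗ (b * d).
Proof.
rewrite /inner_l tliftE // => [{}d|{}c] e x y.
  by rewrite mulrDr -scalerAr tens_linearl.
by rewrite mulrDr -scalerAr tens_linearr.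
Qed.

Let inner_linl t b : linear (fun a => inner_l a b t).
Proof.
move=> e x y; rewrite /inner_l !tlift_sumE scaler_sumr -big_split /=.
apply: eq_bigr => i _; rewrite scaler_sumr -big_split /=; apply: eq_bigr => j _.
by rewrite mulrDl -scalerAl tens_linearl scalerDr !scalerA mulrC.
Qed.

Let inner_linr t a : linear (fun b => inner_l a b t).
Proof.
move=> e x y; rewrite /inner_l !tlift_sumE scaler_sumr -big_split /=.
apply: eq_bigr => i _; rewrite scaler_sumr -big_split /=; apply: eq_bigr => j _.
by rewrite mulrDl -scalerAl tens_linearr scalerDr !scalerA mulrC.
Qed.

Lemma tmulE a b c d : tmul (a ⊗ b) (c ⊗ d) = (a * c) ⊗ (b * d).
Proof.
rewrite /tmul tliftE; first exact: inner_lE.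
  by move=> w; apply: inner_linl.
by move=> v; apply: inner_linr.
Qed.

Let tmul_linl t : linear (tmul^~ t).
Proof. by move=> a x y; rewrite /tmul linearP. Qed.

Let tmul_linr s : linear (tmul s).
Proof.
move=> e x y; rewrite /tmul !tlift_sumE scaler_sumr -big_split /=.
apply: eq_bigr => i _; rewrite scaler_sumr -big_split /=; apply: eq_bigr => j _.
by rewrite linearP scalerDr !scalerA mulrC.
Qed.

Let tensor_ind (P : AB -> Prop) :
  (forall c x y, P x -> P y -> P (c *: x + y)) ->
  (forall a b, P (a ⊗ b)) -> forall t, P t.
Proof.
move=> Plin Ptens t; have P0 : P 0.
  have := Plin (-1) _ _ (Ptens 0 0) (Ptens 0 0).
  by rewrite scaleN1r addNr.
rewrite [t]tensor_decomp; elim/big_rec: _ => // i x _ Px.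
elim/big_rec: _ => [|j y _ Py]; first by rewrite add0r.
by rewrite -addrA; apply: Plin.
Qed.

Let tmulA : associative tmul.
Proof.
move=> x y z; elim/tensor_ind: x => [c x x' Px Px'|a b].
  by rewrite !tmul_linl Px Px'.
elim/tensor_ind: y => [c y y' Py Py'|c d].
  by rewrite !(tmul_linl, tmul_linr) Py Py'.
elim/tensor_ind: z => [e z z' Pz Pz'|e f].
  by rewrite !(tmul_linl, tmul_linr) Pz Pz'.
by rewrite !tmulE !mulrA.
Qed.

Let tmul1 : left_id tone tmul.
Proof.
by elim/tensor_ind=> [c x y Px Py|a b]; rewrite ?tmul_linr ?Px ?Py // tmulE !mul1r.
Qed.

Let tmulr1 : right_id tone tmul.
Proof.
by elim/tensor_ind=> [c x y Px Py|a b]; rewrite ?tmul_linl ?Px ?Py // tmulE !mulr1.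
Qed.

Let tmulDl : left_distributive tmul +%R.
Proof. by move=> x y z; have := tmul_linl z 1 x y; rewrite !scale1r. Qed.

Let tmulDr : right_distributive tmul +%R.
Proof. by move=> x y z; have := tmul_linr x 1 y z; rewrite !scale1r. Qed.

Let tone_neq0 : tone != 0.
Proof.
have coord_ex (X : falgType k) : exists i, coord (vbasis {:X}) i 1 != 0.
  apply/existsP; apply: contraNT (oner_neq0 X) => /existsPn c0.
  rewrite [1](coord_vbasis (memvf 1)) big1 // => i _.
  by have /negPn/eqP-> := c0 i; rewrite scale0r.
have [i ci] := coord_ex A; have [j cj] := coord_ex B.
apply/eqP => /matrixP/(_ i j)/eqP; rewrite !mxE mulf_eq0.
by rewrite (negPf ci) (negPf cj).
Qed.

HB.instance Definition _ := GRing.Zmodule_isNzRing.Build AB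
  tmulA tmul1 tmulr1 tmulDl tmulDr tone_neq0.

Let tscaleAl (c : k) (x y : AB) : c *: (x * y) = (c *: x) * y.
Proof.
have t0 : tmul 0 y = 0 by have := mul0r y.
by have /esym := tmul_linl y c x 0; rewrite /= t0 !addr0.
Qed.

Let tscaleAr (c : k) (x y : AB) : c *: (x * y) = x * (c *: y).
Proof.
have t0 : tmul x 0 = 0 by have := mulr0 x.
by have /esym := tmul_linr x c y 0; rewrite t0 !addr0.
Qed.

HB.instance Definition _ := GRing.Lmodule_isLalgebra.Build k AB tscaleAl.
HB.instance Definition _ := GRing.Lalgebra_isAlgebra.Build k AB tscaleAr.
HB.instance Definition _ := Algebra_isFalgebra.Build k AB.

Lemma tensM (a c : A) (b d : B) :
  (a ⊗ b) * (c ⊗ d) = (a * c) ⊗ (b * d) :> AB.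
Proof. exact: tmulE. Qed.

Lemma tens11 : 1 ⊗ 1 = 1 :> AB.
Proof. by []. Qed.

End TensorAlgebra.

(* The quotient V/U is realised on a complement of U, the class of v being    *)
(* its projection along U; see lker_qmap and limg_qmap.                       *)
Section Quotient.

Variables (k : fieldType) (V : vectType k) (U : {vspace V}).

Definition quotv : vectType k := subvs_of (U^C)%VS.

Definition qmap : 'Hom(V, quotv) :=
  (linfun (vsproj (U^C)%VS) \o (\1 - projv U))%VF.

Let val_qmap v : vsval (qmap v) = v - projv U v.
Proof.
by rewrite comp_lfunE lfunE /= add_lfunE opp_lfunE id_lfunE vsprojK ?memv_projC.
Qed.

Lemma lker_qmap : lker qmap = U.
Proof.
apply/vspaceP => v; rewrite memv_ker -(inj_eq subvs_inj) val_qmap linear0.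
rewrite subr_eq0; apply/eqP/idP => [->|Uv]; first exact: memv_proj.
by rewrite projv_id.
Qed.

Lemma limg_qmap : limg qmap = fullv.
Proof.
apply/eqP; rewrite eqEsubv subvf; apply/subvP => x _.
apply/memv_imgP; exists (vsval x); first exact: memvf.
apply: subvs_inj; rewrite val_qmap.
suff -> : projv U (vsval x) = 0 by rewrite subr0.
by apply/eqP; rewrite -memv_ker lker_proj subvsP.
Qed.

End Quotient.

(* The left radical of a bilinear map. *)
Section Radical.

Variables (k : fieldType) (V W U : vectType k) (f : V -> W -> U).

Definition lradical : {vspace V} :=
  lker (linfun (fun v => linfun (f v) : 'Hom(W, U))).

Lemma lradicalP :
  (forall w, linear (f^~ w)) -> (forall v, linear (f v)) ->
  forall v, reflect (forall w, f v w = 0) (v \in lradical).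
Proof.
move=> fl fr v.
have frE u w : (linfun (f u) : 'Hom(W, U)) w = f u w.
  pose F := GRing.isLinear.Build k W U *:%R (f u) (fr u).
  pose f' : {linear W -> U} := HB.pack (f u) F.
  exact: (lfunE f').
have fl' : linear (fun u => linfun (f u) : 'Hom(W, U)).
  move=> a x y; apply/lfunP => w.
  by rewrite add_lfunE scale_lfunE !frE fl.
pose F := GRing.isLinear.Build k V 'Hom(W, U) *:%R _ fl'.
pose f' : {linear V -> 'Hom(W, U)} :=
  HB.pack (fun u => linfun (f u) : 'Hom(W, U)) F.
rewrite memv_ker (lfunE f'); apply: (iffP eqP) => [/lfunP f0 w|f0].
  by rewrite -frE f0 zero_lfunE.
by apply/lfunP => w; rewrite zero_lfunE frE.
Qed.

End Radical.

Section HopfAlgebra.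

Variables (k : fieldType) (A : falgType k).
Local Notation AA := (tensor A A).

Record hopf := Hopf {
  comul : 'Hom(A, AA);
  counit : 'Hom(A, k^o);
  antipode : 'End(A);
  comulM : forall a b, comul (a * b) = comul a * comul b;
  comul1 : comul 1 = 1;
  counitM : forall a b, counit (a * b) = counit a * counit b;
  counit1 : counit 1 = 1;
  comulA : forall a,
    tassoc A A A (tmap comul \1%VF (comul a)) = tmap \1%VF comul (comul a);
  comul_counitl : forall a,
    tlift (fun x y => (counit x : k) *: y) (comul a) = a;
  comul_counitr : forall a,
    tlift (fun x y => (counit y : k) *: x) (comul a) = a;
  antipodel : forall a,
    tlift (fun x y => antipode x * y) (comul a) = (counit a : k) *: 1;
  antipoder : forall a,
    tlift (fun x y => x * antipode y) (comul a) = (counit a : k) *: 1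
}.

Variable H : hopf.
Local Notation Δ := (comul H).
Local Notation ε := (counit H).
Local Notation S := (antipode H).

Local Notation AAA := (tensor A AA).

Definition leg12 (R : AA) : AAA := tlift (fun a b : A => a ⊗ (b ⊗ (1 : A))) R.
Definition leg13 (R : AA) : AAA := tlift (fun a b : A => a ⊗ ((1 : A) ⊗ b)) R.
Definition leg23 (R : AA) : AAA := (1 : A) ⊗ R.

Definition quasitriangular (R : AA) : Prop :=
  [/\ R \is a GRing.unit,
      forall a, tflip A A (Δ a) = R * Δ a * R^-1,
      tassoc A A A (tmap Δ \1%VF R) = leg13 R * leg23 R
    & tmap \1%VF Δ R = leg13 R * leg12 R].

Definition drinfeld (R : AA) : A := tlift (fun α β => S β * α) R.

Definition ribbon_elt (R : AA) (g : A) : A := g * (drinfeld R)^-1.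

(* The third and fourth clauses follow from the first two (Drinfeld's theorem *)
(* that u = drinfeld R is invertible and implements the square of S).         *)
Definition ribbon (R : AA) (g : A) : Prop :=
  [/\ quasitriangular R,
      [/\ g \is a GRing.unit, Δ g = g ⊗ g & forall a, S (S a) = g * a * g^-1],
      drinfeld R \is a GRing.unit /\ ribbon_elt R g = (drinfeld R)^-1 * g,
      forall a, ribbon_elt R g * a = a * ribbon_elt R g
    & S (ribbon_elt R g) = ribbon_elt R g].

Definition left_integral (x : A) : Prop := forall a, a * x = (ε a : k) *: x.
Definition right_integral (x : A) : Prop := forall a, x * a = (ε a : k) *: x.
Definition unimodular : Prop :=
  forall x, left_integral x <-> right_integral x.

Definition right_integral_dual (lam : 'Hom(A, k^o)) : Prop :=
  forall a, tlift (fun x y => (lam x : k) *: y) (Δ a) = (lam a : k) *: 1.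

Definition ZA : {vspace A} := 'Z({:A})%VS.

Lemma ZP (a : A) : reflect (forall b, a * b = b * a) (a \in ZA).
Proof.
rewrite memv_cap memvf /=; apply: (iffP centvP) => ca b; last by rewrite ca.
exact/ca/memvf.
Qed.

Section Integral.

Variable lam : 'Hom(A, k^o).

Definition KA : {vspace subvs_of ZA} :=
  lradical (fun a b : subvs_of ZA => lam (vsval a * vsval b)).

Lemma KP (a : subvs_of ZA) :
  reflect (forall b : A, b \in ZA -> lam (vsval a * b) = 0) (a \in KA).
Proof.
apply: (iffP (lradicalP _ _ _)) => [b c x y|b c x y|a0 b Zb|a0 b].
- by rewrite linearP /= mulrDl -scalerAl linearP.
- by rewrite linearP /= mulrDr -scalerAr linearP.
- by have := a0 (Subvs Zb).
by rewrite a0 ?subvsP.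
Qed.

Definition Zhat : vectType k := quotv KA.

Definition C2 : {vspace AA} := 'C(limg Δ)%VS.

Lemma C2P (x : AA) : reflect (forall b, Δ b * x = x * Δ b) (x \in C2).
Proof.
apply: (iffP centvP) => cx; first by move=> b; rewrite cx ?memv_img ?memvf.
by move=> _ /memv_imgP[b _ ->]; rewrite cx.
Qed.

(* The span of the (a (x) b) * comul c with a, b, c in ZA; see mem_C2Z_gen    *)
(* and C2Z_min.                                                               *)
Definition C2Z_gen : {vspace AA} :=
  (<<[seq a ⊗ b | a <- vbasis ZA, b <- vbasis ZA]>> * (Δ @: ZA))%VS.

Definition C2Z : {aspace AA} := <<C2Z_gen>>%AS.

Lemma mem_C2Z_gen a b c :
  a \in ZA -> b \in ZA -> c \in ZA -> (a ⊗ b) * Δ c \in C2Z.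
Proof.
move=> Za Zb Zc; apply/(subvP (sub_agenv _))/memv_mul; last exact: memv_img.
rewrite (coord_vbasis Za) (coord_vbasis Zb).
pose X := [seq a ⊗ b | a <- vbasis ZA, b <- vbasis ZA].
rewrite -/X.
have tl (w : A) : linear (fun v : A => v ⊗ w) by move=> e x y; apply: tens_linearl.
have tr (v : A) : linear (fun w : A => v ⊗ w) by exact: tens_linearr.
have t0 (w : A) : (0 : A) ⊗ w = 0.
  by have := tl w (-1) 0 0; rewrite scaler0 addr0 scaleN1r addNr.
have tr0 (v : A) : v ⊗ (0 : A) = 0.
  by have := tr v (-1) 0 0; rewrite scaler0 addr0 scaleN1r addNr.
elim/big_rec: _ => [|i x _ IH]; first by rewrite t0 mem0v.
rewrite tl memvD ?memvZ //.
elim/big_rec: _ => [|j y _ IHy]; first by rewrite tr0 mem0v.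
rewrite tr memvD ?memvZ ?IHy // memv_span //.
by apply: allpairs_f; rewrite mem_nth ?size_tuple.
Qed.

Lemma C2Z_min (B : {aspace AA}) :
  1 \in B ->
  (forall a b c, a \in ZA -> b \in ZA -> c \in ZA -> (a ⊗ b) * Δ c \in B) ->
  (C2Z <= B)%VS.
Proof.
move=> B1 Bg; apply: agenv_sub_modl; first by rewrite -memvE.
have gB : (C2Z_gen <= B)%VS.
  apply/prodvP => t _ Xt /memv_imgP[c Zc ->].
  suff /subvP/(_ t Xt) :
      (<<[seq a ⊗ b | a <- vbasis ZA, b <- vbasis ZA]>>
        <= amulr (Δ c) @^-1: B)%VS by rewrite -memv_preim lfunE.
  apply/span_subvP => _ /allpairsP[[a b] /= [Za Zb ->]].
  by rewrite -memv_preim lfunE /= Bg // vbasis_mem.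
exact: subv_trans (prodvSl _ gB) (asubv _).
Qed.

Definition mu (x y : AA) : k^o :=
  tlift (fun a b => tlift (fun c d => lam (a * c) * lam (b * d)) y) x.

Lemma mu_linearl y : linear (mu^~ y).
Proof. by move=> c x x'; rewrite /mu linearP. Qed.

Lemma mu_linearr x : linear (mu x).
Proof.
move=> e y y'; rewrite /mu !tlift_sumE scaler_sumr -big_split /=.
apply: eq_bigr => i _; rewrite scaler_sumr -big_split /=; apply: eq_bigr => j _.
by rewrite linearP scalerDr !scalerA mulrC.
Qed.

Lemma muE a b c d : mu (a ⊗ b) (c ⊗ d) = lam (a * c) * lam (b * d).
Proof.
have inner_linl t b' : linear (fun a' : A => tlift (fun c d : A =>
    (lam (a' * c) * lam (b' * d) : k^o)) t).
  move=> e x y; rewrite !tlift_sumE scaler_sumr -big_split /=.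
  apply: eq_bigr => i _; rewrite scaler_sumr -big_split /=; apply: eq_bigr => j _.
  rewrite mulrDl -scalerAl linearP mulrDl -scalerAl scalerDr; congr (_ + _).
  by rewrite [LHS]scalerA [RHS]scalerA mulrC.
have inner_linr t a' : linear (fun b' : A => tlift (fun c d : A =>
    (lam (a' * c) * lam (b' * d) : k^o)) t).
  move=> e x y; rewrite !tlift_sumE scaler_sumr -big_split /=.
  apply: eq_bigr => i _; rewrite scaler_sumr -big_split /=; apply: eq_bigr => j _.
  rewrite mulrDl -scalerAl linearP mulrDr -scalerAr scalerDr; congr (_ + _).
  by rewrite [LHS]scalerA [RHS]scalerA mulrC.
rewrite /mu tliftE; [|by move=> w; apply: inner_linl|by move=> w; apply: inner_linr].
rewrite tliftE // => [w|v] e x y.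
  by rewrite mulrDr -scalerAr linearP mulrDl -scalerAl.
by rewrite mulrDr -scalerAr linearP mulrDr -scalerAr.
Qed.

Definition K2Z : {vspace subvs_of C2Z} :=
  lradical (fun (x : subvs_of C2Z) (y : subvs_of C2) => mu (vsval x) (vsval y)).

Lemma K2ZP (x : subvs_of C2Z) :
  reflect (forall y : AA, y \in C2 -> mu (vsval x) y = 0) (x \in K2Z).
Proof.
apply: (iffP (lradicalP _ _ _)) => [y c x1 x2|x' c y1 y2|x0 y Cy|x0 y].
- by rewrite linearP mu_linearl.
- by rewrite linearP mu_linearr.
- by have := x0 (Subvs Cy).
by rewrite x0 ?subvsP.
Qed.

Definition C2Zhat : vectType k := quotv K2Z.

End Integral.

End HopfAlgebra.

(* Main.v *)
(* Write E(y) = (λ ⊗ id)(y). Two facts carry the proof. First, the slices     *)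
(* λ(Λ1 a) Λ2 = S(a) and λ(S(a) Λ1) Λ2 = a of the integral give at once the   *)
(* antimultiplicativity of S and, comparing λ(S²(x) Λ1) Λ2 with λ(Λ1 x) Λ2,   *)
(* the identity λ(S²(x) y) = λ(y x). Second, that identity makes E(y) and     *)
(* F(y) = Σ c1 λ(S(c2) d) central for y = Σ c ⊗ d in C2, while                *)
(* (λ ⊗ λ)((1 ⊗ w) y) = λ(w E(y)) and (λ ⊗ λ)(Δ(z) y) = λ(z F(y)). Every      *)
(* pairing of δ(w, z) with C2 thus has the form λ(w b) or λ(z b), b central,  *)
(* except (λ ⊗ λ)((z ⊗ w) y) for z in K(A); the braided flip                  *)
(* y |-> R^-1 T(y) R, which preserves C2 and λ ⊗ λ, reduces it to the         *)
(* case of w in K(A).                                                         *)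

From HB Require Import structures.
Require Import Defs.
From mathcomp Require Import all_boot all_order all_algebra all_field.

Import GRing.Theory.

Local Open Scope ring_scope.

(** Descent amounts to this: δ(w, z) lies in the radical [K2Z] as soon as w or z lies in [KA]. By
    [mu_slicel] the pairing of x and y is (λ ⊗ λ)(x y), so both terms of δ(w, z) have to be tested
    against every y in [C2]. If w is in [KA], both tests have the form λ(w E(y')) with y' in [C2],
    and [slicel_C2_central] applies ([slice_radical]). If z is in [KA], the term with Δ(z) is λ(z
    F(y')) by [slicel_comul_mul], with F(y') central by [slicer_untwist_central], while the term z ⊗
    w is flipped with [tflip_C2] and [slice_conj] ([slice_radical_flip]). Throughout,
    [tlift f (Δ a)] plays the role of the Sweedler sum Σ f(a1, a2). *)

Section TensorCalculus.

Context {k : fieldType}.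

(** * Calculus of Sweedler sums *)

Lemma tensor_ind (V W : vectType k) (P : tensor V W -> Prop) :
  (forall c x y, P x -> P y -> P (c *: x + y)) ->
  (forall v w, P (v ⊗ w)) -> forall t, P t.
Proof.
move=> Plin Ptens t; have P0 : P 0.
  by have := Plin (-1) _ _ (Ptens 0 0) (Ptens 0 0); rewrite scaleN1r addNr.
rewrite [t]tensor_decomp; elim/big_rec: _ => // i x _ Px.
elim/big_rec: _ => [|j y _ Py]; first by rewrite add0r.
by rewrite -addrA; apply: Plin.
Qed.

Lemma eq_tlift {V W U : vectType k} (f h : V -> W -> U) (t : tensor V W) :
  (forall v w, f v w = h v w) -> tlift f t = tlift h t.
Proof.
move=> fh; rewrite !tlift_sumE; apply: eq_bigr => i _; apply: eq_bigr => j _.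
by rewrite fh.
Qed.

Lemma linear_tlift {V W U U' : vectType k} (h : U -> U') (f : V -> W -> U)
    (t : tensor V W) :
  linear h -> h (tlift f t) = tlift (fun v w => h (f v w)) t.
Proof.
move=> hl; pose L := GRing.isLinear.Build k U U' *:%R h hl.
pose h' : {linear U -> U'} := HB.pack h L.
rewrite !tlift_sumE -[h _]/(h' _) linear_sum; apply: eq_bigr => i _.
by rewrite linear_sum; apply: eq_bigr => j _; rewrite linearZ.
Qed.

Lemma tlift_tens {V W : vectType k} (t : tensor V W) : tlift (@tens k V W) t = t.
Proof. by rewrite tlift_sumE -tensor_decomp. Qed.

Lemma tlift_linear_fun {V W U X : vectType k} (f : X -> V -> W -> U)
    (t : tensor V W) :
  (forall v w, linear (fun x => f x v w)) -> linear (fun x => tlift (f x) t).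
Proof.
move=> fl c x y; rewrite !tlift_sumE scaler_sumr -big_split /=.
apply: eq_bigr => i _; rewrite scaler_sumr -big_split /=; apply: eq_bigr => j _.
by rewrite fl scalerDr !scalerA mulrC.
Qed.

Lemma tensZl {V W : vectType k} c (v : V) (w : W) : (c *: v) ⊗ w = c *: (v ⊗ w).
Proof. by apply/matrixP => i j; rewrite !mxE linearZ /= mulrA. Qed.

Lemma tensZr {V W : vectType k} c (v : V) (w : W) : v ⊗ (c *: w) = c *: (v ⊗ w).
Proof. by apply/matrixP => i j; rewrite !mxE linearZ /= mulrCA. Qed.

Lemma tensDl {V W : vectType k} (v v' : V) (w : W) :
  (v + v') ⊗ w = v ⊗ w + v' ⊗ w.
Proof. by apply/matrixP => i j; rewrite !mxE linearD /= mulrDl. Qed.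

Lemma tensDr {V W : vectType k} (v : V) (w w' : W) :
  v ⊗ (w + w') = v ⊗ w + v ⊗ w'.
Proof. by apply/matrixP => i j; rewrite !mxE linearD /= mulrDr. Qed.

End TensorCalculus.

Arguments tensor_ind : clear implicits.

(** Clears the side conditions of Sweedler computations: an expression is linear in one of its
    slots. *)
Ltac linear_tac :=
  intros; let c := fresh "c" in let x := fresh "x" in let y := fresh "y" in
  move=> c x y /=;
  repeat progress rewrite ?(linearD, linearZ, tensDl, tensDr, tensZl, tensZr,
    mulrDl, mulrDr, scalerDl, scalerDr) -?(scalerAl, scalerAr) /=;
  rewrite ?scalerA; try done; try by rewrite mulrC.

(** * Sweedler identities and integrals in a Hopf algebra *)

Section Hopf.

Context {k : fieldType} {A : falgType k}.
Variable H : hopf A.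
Local Notation AA := (tensor A A).
Local Notation Δ := (comul H).
Local Notation ε := (counit H).
Local Notation S := (antipode H).

(** Coassociativity as used in Sweedler notation: apply to [comulA] the linear map on A ⊗ (A ⊗ A)
    induced by the trilinear T. *)
Lemma coassoc_tlift {U : vectType k} (T : A -> A -> A -> U) :
  (forall y z, linear (fun x => T x y z)) ->
  (forall x z, linear (fun y => T x y z)) ->
  (forall x y, linear (fun z => T x y z)) ->
  forall a, tlift (fun x z => tlift (fun u v => T u v z) (Δ x)) (Δ a) =
            tlift (fun x y => tlift (T x) (Δ y)) (Δ a).
Proof.
move=> T1 T2 T3 a.
pose L : 'Hom(tensor A AA, U) := tlift (fun x t => tlift (T x) t).
have LE x t : L (x ⊗ t) = tlift (T x) t.
  rewrite /L tliftE // => [{}t|{}x].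
    by apply: tlift_linear_fun => v w; apply: T1.
  exact: linearP.
have := congr1 L (comulA H a).
rewrite /tmap (linear_tlift (tassoc A A A)) ?(linear_tlift L); try exact:
  linearP.
move=> E; transitivity (tlift (fun x y => L (tassoc A A A (Δ x ⊗ \1%VF y))) (Δ a)).
  apply: eq_tlift => x z; rewrite id_lfunE /tassoc tliftE => [|w|v].
  - by rewrite linear_tlift; [apply: eq_tlift => u v; rewrite LE tliftE|exact:
    linearP].
  - exact: linearP.
  by apply: tlift_linear_fun => u w; linear_tac.
by rewrite E; apply: eq_tlift => x y; rewrite id_lfunE LE.
Qed.

Lemma antipode_comul a :
  tlift (fun x y => (S x ⊗ 1) * Δ y : AA) (Δ a) = 1 ⊗ a.
Proof.
transitivity (tlift (fun x y => tlift (fun u v => (S x * u) ⊗ v) (Δ y)) (Δ a)).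
  apply: eq_tlift => x y; rewrite -{1}[Δ y]tlift_tens linear_tlift;
    last by linear_tac.
  by apply: eq_tlift => u v; rewrite tensM mul1r.
rewrite -(coassoc_tlift (fun x u v => (S x * u) ⊗ v)); [|by linear_tac..].
rewrite -[X in _ = _ ⊗ X](comul_counitl H a) linear_tlift; last by linear_tac.
apply: eq_tlift => x y.
rewrite -(linear_tlift (fun w => w ⊗ y)) ?antipodel; last by linear_tac.
by rewrite tensZl tensZr.
Qed.

Lemma comul_antipode a :
  tlift (fun x y => Δ x * (1 ⊗ S y) : AA) (Δ a) = a ⊗ 1.
Proof.
transitivity (tlift (fun x y => tlift (fun u v => u ⊗ (v * S y)) (Δ x)) (Δ a)).
  apply: eq_tlift => x y; rewrite -{1}[Δ x]tlift_tens
    (linear_tlift (fun w : AA => w * _)).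
    by apply: eq_tlift => u v; rewrite tensM mulr1.
  by linear_tac.
rewrite (coassoc_tlift (fun x u v => x ⊗ (u * S v))); [|by linear_tac..].
rewrite -[X in _ = X ⊗ _](comul_counitr H a) (linear_tlift (fun w => w ⊗ 1));
  last by linear_tac.
apply: eq_tlift => x y.
rewrite -(linear_tlift (fun w => x ⊗ w)) ?antipoder; last by linear_tac.
by rewrite tensZl tensZr.
Qed.

(** Write 1 ⊗ a = Σ (S(a1) ⊗ 1) Δ(a2) by [antipode_comul]; the integral absorbs a2 as ε(a2). *)
Lemma left_integral_comul L a : left_integral H L ->
  (1 ⊗ a) * Δ L = (S a ⊗ 1) * Δ L.
Proof.
move=> intL; rewrite -antipode_comul (linear_tlift (fun w : AA => w * _));
  last by linear_tac.
rewrite -[in RHS](comul_counitr H a) linear_tlift; last exact: linearP.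
rewrite (linear_tlift (fun w => w ⊗ 1)); last by linear_tac.
rewrite (linear_tlift (fun w : AA => w * _)); last by linear_tac.
apply: eq_tlift => x y.
by rewrite -mulrA -comulM intL !linearZ /= tensZl -scalerAl scalerAr.
Qed.

(** Mirror argument, with a ⊗ 1 = Σ Δ(a1) (1 ⊗ S(a2)). *)
Lemma right_integral_comul L a : right_integral H L ->
  Δ L * (a ⊗ 1) = Δ L * (1 ⊗ S a).
Proof.
move=> intL; rewrite -comul_antipode (linear_tlift (fun w : AA => _ * w));
  last by linear_tac.
rewrite -[in RHS](comul_counitl H a) linear_tlift; last exact: linearP.
rewrite (linear_tlift (fun w => 1 ⊗ w)); last by linear_tac.
rewrite (linear_tlift (fun w : AA => _ * w)); last by linear_tac.
apply: eq_tlift => x y.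
by rewrite mulrA -comulM intL !linearZ /= tensZr -scalerAl scalerAr.
Qed.

End Hopf.

(** * Contracting one tensor factor with a functional *)

Section Slices.

Context {k : fieldType} {A : falgType k}.
Local Notation AA := (tensor A A).

Lemma central_tens (w z : A) (t : AA) :
  w \in ZA A -> z \in ZA A -> (w ⊗ z) * t = t * (w ⊗ z).
Proof.
move=> /ZP wC /ZP zC; elim/tensor_ind: t => [c x y IHx IHy|x y].
  by rewrite mulrDl mulrDr -scalerAl -scalerAr IHx IHy.
by rewrite !tensM wC zC.
Qed.

Lemma tflipE (a b : A) : tflip A A (a ⊗ b) = b ⊗ a.
Proof. by rewrite /tflip tliftE // => [x|x]; linear_tac. Qed.

Lemma tflipM (s t : AA) : tflip A A (s * t) = tflip A A s * tflip A A t.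
Proof.
elim/tensor_ind: s => [c x y IHx IHy|a b].
  by rewrite mulrDl -scalerAl !linearP /= IHx IHy mulrDl -scalerAl.
elim/tensor_ind: t => [c x y IHx IHy|u v].
  by rewrite mulrDr -scalerAr !linearP /= IHx IHy mulrDr -scalerAr.
by rewrite tensM !tflipE tensM.
Qed.

(** The map f ⊗ id, so that [slicel lam] is E. The functional stays a parameter because
    [slice_integral_inj] lets it vary. *)
Definition slicel (f : 'Hom(A, k^o)) : 'Hom(AA, A) :=
  tlift (fun x y => (f x : k) *: y).

Definition slicer (f : 'Hom(A, k^o)) : 'Hom(AA, A) :=
  tlift (fun x y => (f y : k) *: x).

Lemma slicelE f a b : slicel f (a ⊗ b) = (f a : k) *: b.
Proof.
rewrite /slicel tliftE // => [y|x] c u v; first by rewrite linearP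
  scalerDl -scalerA.
by rewrite scalerDr !scalerA mulrC.
Qed.

Lemma slicerE f a b : slicer f (a ⊗ b) = (f b : k) *: a.
Proof.
rewrite /slicer tliftE // => [y|x] c u v; last by rewrite linearP
  scalerDl -scalerA.
by rewrite scalerDr !scalerA mulrC.
Qed.

Lemma slicel_mulr f (t : AA) b : slicel f (t * (1 ⊗ b)) = slicel f t * b.
Proof.
elim/tensor_ind: t => [c x y IHx IHy|x y].
  by rewrite mulrDl -scalerAl !linearP /= mulrDl -scalerAl IHx IHy.
by rewrite tensM mulr1 !slicelE scalerAl.
Qed.

Lemma slicel_mull f (t : AA) b : slicel f ((1 ⊗ b) * t) = b * slicel f t.
Proof.
elim/tensor_ind: t => [c x y IHx IHy|x y].
  by rewrite mulrDr -scalerAr !linearP /= mulrDr -scalerAr IHx IHy.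
by rewrite tensM mul1r !slicelE scalerAr.
Qed.

Lemma slicer_mulr f (t : AA) b : slicer f (t * (b ⊗ 1)) = slicer f t * b.
Proof.
elim/tensor_ind: t => [c x y IHx IHy|x y].
  by rewrite mulrDl -scalerAl !linearP /= mulrDl -scalerAl IHx IHy.
by rewrite tensM mulr1 !slicerE scalerAl.
Qed.

Lemma slicer_mull f (t : AA) b : slicer f ((b ⊗ 1) * t) = b * slicer f t.
Proof.
elim/tensor_ind: t => [c x y IHx IHy|x y].
  by rewrite mulrDr -scalerAr !linearP /= mulrDr -scalerAr IHx IHy.
by rewrite tensM mul1r !slicerE scalerAr.
Qed.

Lemma slicel_amull f u (t : AA) :
  slicel (f \o amull u)%VF t = slicel f ((u ⊗ 1) * t).
Proof.
elim/tensor_ind: t => [c x y IHx IHy|x y].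
  by rewrite mulrDr -scalerAr !linearP /= IHx IHy.
by rewrite tensM mul1r !slicelE comp_lfunE lfunE.
Qed.

Lemma slicel_amulr f u (t : AA) :
  slicel (f \o amulr u)%VF t = slicel f (t * (u ⊗ 1)).
Proof.
elim/tensor_ind: t => [c x y IHx IHy|x y].
  by rewrite mulrDl -scalerAl !linearP /= IHx IHy.
by rewrite tensM mulr1 !slicelE comp_lfunE lfunE.
Qed.

Lemma slicel_is_linear (t : AA) : linear (slicel^~ t).
Proof.
by apply: tlift_linear_fun => v w c x y; rewrite add_lfunE scale_lfunE
  scalerDl scalerA.
Qed.

Lemma mu_slicel (f : 'Hom(A, k^o)) (x y : AA) : mu f x y = f (slicel f (x * y)).
Proof.
elim/tensor_ind: x => [c x x' IHx IHx'|a b].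
  by rewrite mu_linearl IHx IHx' mulrDl -scalerAl !linearP.
elim/tensor_ind: y => [c x x' IHx IHx'|c d].
  by rewrite mu_linearr IHx IHx' mulrDr -scalerAr !linearP.
by rewrite muE tensM slicelE linearZ.
Qed.

End Slices.

(** * Slices of the integral and the twisted trace property of λ *)

Section Integral.

Context {k : fieldType} {A : falgType k}.
Variables (H : hopf A) (Lambda : A) (lam : 'Hom(A, k^o)).
Hypotheses (intl : left_integral H Lambda) (intr : right_integral H Lambda).
Hypotheses (intlam : right_integral_dual H lam) (lamL : lam Lambda = 1).
Local Notation AA := (tensor A A).
Local Notation Δ := (comul H).
Local Notation ε := (counit H).
Local Notation S := (antipode H).

Lemma slicel_comul a : slicel lam (Δ a) = (lam a : k) *: 1.
Proof. exact: intlam. Qed.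

Lemma antipode_slice a : S a = slicel lam (Δ Lambda * (a ⊗ 1)).
Proof.
by rewrite right_integral_comul // slicel_mulr slicel_comul lamL scale1r mul1r.
Qed.

Lemma slice_antipode a : slicel lam ((S a ⊗ 1) * Δ Lambda) = a.
Proof.
by rewrite -left_integral_comul // slicel_mull slicel_comul lamL scale1r mulr1.
Qed.

Lemma antipode1 : S 1 = 1.
Proof. by rewrite antipode_slice tens11 mulr1 slicel_comul lamL scale1r. Qed.

(** In λ(Λ1 a b) Λ2, the factor a crosses to the second leg as S(a) on the right, leaving λ(Λ1 b) Λ2
    = S(b). *)
Lemma antipodeM a b : S (a * b) = S b * S a.
Proof.
rewrite antipode_slice.
have -> : (a * b) ⊗ 1 = (a ⊗ 1) * (b ⊗ 1) :> AA by rewrite tensM mulr1.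
rewrite mulrA right_integral_comul // -mulrA.
have -> : (1 ⊗ S a) * (b ⊗ 1) = (b ⊗ 1) * (1 ⊗ S a) :> AA.
  by rewrite !tensM !mul1r !mulr1.
by rewrite mulrA slicel_mulr -antipode_slice.
Qed.

(* The slices [f(Λ1) Λ2] fill [A], so by a dimension count [f(Λ1) Λ2 = 0]     *)
(* forces [f = 0].                                                            *)
Lemma slice_integral_inj f : slicel f (Δ Lambda) = 0 -> f = 0.
Proof.
pose G (f : 'Hom(A, k^o)) := slicel f (Δ Lambda).
have lG : linear G by exact: slicel_is_linear.
pose GL := GRing.isLinear.Build k _ _ *:%R G lG.
pose G' : {linear 'Hom(A, k^o) -> A} := HB.pack G GL.
have surj : limg (linfun G') = fullv.
  apply/eqP; rewrite eqEsubv subvf; apply/subvP => a _; apply/memv_imgP.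
  (* By [slice_antipode], the functional λ(S(a) ·) has slice a. *)
  exists (lam \o amull (S a))%VF; first exact: memvf.
  by rewrite lfunE /= /G slicel_amull slice_antipode.
have := limg_ker_dim (linfun G') fullv.
rewrite surj capfv !dimvf /dim /= muln1 => /eqP.
rewrite -[X in _ == X]add0n eqn_add2r dimv_eq0 => /lker0P inj G0.
by apply: (inj f 0); rewrite linear0 (lfunE G').
Qed.

(** Both sides are functionals of y with the same slice S(x) of ΔΛ, hence equal by
    [slice_integral_inj]. *)
Lemma integral_antipode2 x y : lam (S (S x) * y) = lam (y * x).
Proof.
pose f := ((lam \o amull (S (S x))) - (lam \o amulr x))%VF.
suff /lfunP/(_ y): f = 0.
  by rewrite /f add_lfunE opp_lfunE !comp_lfunE !lfunE /= => /eqP; rewrite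
    subr_eq0 => /eqP.
apply: slice_integral_inj.
have := slicel_is_linear (Δ Lambda) (-1) (lam \o amulr x)%VF
  (lam \o amull (S (S x)))%VF.
rewrite !scaleN1r /f [(_ - _)%VF]addrC => ->.
by rewrite slicel_amull slicel_amulr slice_antipode -antipode_slice addNr.
Qed.

(** * Centrality of E on [C2] *)

Lemma slicel_twist x (t : AA) :
  slicel lam (t * (x ⊗ 1)) = slicel lam ((S (S x) ⊗ 1) * t).
Proof.
rewrite -slicel_amulr -slicel_amull; congr (slicel _ t).
by apply/lfunP => y; rewrite !comp_lfunE !lfunE /= integral_antipode2.
Qed.

Lemma slicer_twist x (t : AA) :
  slicer lam (t * (1 ⊗ x)) = slicer lam ((1 ⊗ S (S x)) * t).
Proof.
elim/tensor_ind: t => [c u v IHu IHv|a b].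
  by rewrite mulrDl mulrDr -scalerAl -scalerAr !linearP /= IHu IHv.
by rewrite !tensM mul1r mulr1 !slicerE integral_antipode2.
Qed.

(** For y commuting with the coproducts, b E(y) = Σ E((S(b1) ⊗ 1) Δ(b2) y) = Σ E((S(b1) ⊗ 1) y (b2 ⊗
    b3)). The twist moves b2 to the left as S²(b2), and S²(b2) S(b1) = S(b1 S(b2)) collapses,
    leaving E(y) b. *)
Lemma slicel_C2_central y : y \in C2 H -> slicel lam y \in ZA A.
Proof.
move=> /C2P yC; apply/ZP => b; symmetry.
rewrite -slicel_mull -(antipode_comul H b).
rewrite (linear_tlift (fun w : AA => slicel lam (w * y))); last by linear_tac.
pose T p u v := slicel lam (((S (S u) * S p) ⊗ 1 : AA) * y) * v.
transitivity (tlift (fun p q => tlift (T p) (Δ q)) (Δ b)).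
  apply: eq_tlift => p q; rewrite -mulrA yC mulrA -{1}[Δ q]tlift_tens.
  rewrite (linear_tlift (fun w : AA => slicel lam (_ * w))); last by linear_tac.
  apply: eq_tlift => u v.
  have -> : u ⊗ v = (1 ⊗ v) * (u ⊗ 1) :> AA by rewrite tensM mul1r mulr1.
  by rewrite mulrA slicel_twist !mulrA slicel_mulr tensM mulr1.
rewrite -(coassoc_tlift H T); [|by rewrite /T; linear_tac..].
rewrite -[in RHS](comul_counitl H b) (linear_tlift (fun w => _ * w));
  last by linear_tac.
apply: eq_tlift => p q.
transitivity (tlift (fun u v => slicel lam ((S (u * S v) ⊗ 1 : AA) * y) * q) (Δ p)).
  by apply: eq_tlift => u v; rewrite /T antipodeM.
rewrite -(linear_tlift (fun w => slicel lam ((S w ⊗ 1 : AA) * y) * q));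
  last by linear_tac.
by rewrite antipoder linearZ /=
  antipode1 tensZl -scalerAl mul1r linearZ /= -scalerAl scalerAr.
Qed.

(** * The map F and its centrality on [C2] *)

Local Notation Ψ := (tmap \1%VF S).

Lemma tmapS_mull p q (t : AA) : Ψ ((p ⊗ q) * t) = (p ⊗ 1) * Ψ t * (1 ⊗ S q).
Proof.
elim/tensor_ind: t => [c u v IHu IHv|u v].
  by rewrite mulrDr -scalerAr !linearP /= IHu IHv mulrDr -scalerAr
    mulrDl -scalerAl.
by rewrite tensM !tmapE !id_lfunE !tensM antipodeM mulr1 mul1r.
Qed.

Lemma tmapS_mulr p q (t : AA) : Ψ (t * (p ⊗ q)) = (1 ⊗ S q) * Ψ t * (p ⊗ 1).
Proof.
elim/tensor_ind: t => [c u v IHu IHv|u v].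
  by rewrite mulrDl -scalerAl !linearP /= IHu IHv mulrDr -scalerAr
    mulrDl -scalerAl.
by rewrite tensM !tmapE !id_lfunE !tensM antipodeM mulr1 mul1r.
Qed.

(* In Sweedler notation c ⊗ d |-> c1 ⊗ S(c2) d, the inverse of               *)
(* c ⊗ d |-> c1 ⊗ c2 d.                                                       *)
Definition untwist : 'Hom(AA, AA) := tlift (fun c d => Ψ (Δ c) * (1 ⊗ d)).

Lemma untwistE c d : untwist (c ⊗ d) = Ψ (Δ c) * (1 ⊗ d).
Proof. by rewrite /untwist tliftE // => [x|x]; linear_tac. Qed.

(** For y = c ⊗ d the left side is Σ b1 c1 ⊗ S(c2) S(b2) b3 d, and S(b2) b3 collapses. *)
Lemma untwist_comull b (y : AA) : untwist (Δ b * y) = (b ⊗ 1) * untwist y.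
Proof.
elim/tensor_ind: y => [e u v IHu IHv|c d].
  by rewrite mulrDr -scalerAr !linearP /= IHu IHv mulrDr -scalerAr.
rewrite -{1}[Δ b]tlift_tens (linear_tlift (fun w : AA => untwist (w * _)));
  last by linear_tac.
pose T p q v := (p ⊗ 1 : AA) * Ψ (Δ c) * (1 ⊗ (S q * v * d)).
transitivity (tlift (fun x z => tlift (fun p q => T p q z) (Δ x)) (Δ b)).
  apply: eq_tlift => u v; rewrite tensM untwistE comulM -{1}[Δ u]tlift_tens.
  rewrite (linear_tlift (fun w : AA => Ψ (w * _) * _)); last by linear_tac.
  by apply: eq_tlift => p q; rewrite tmapS_mull -[LHS]mulrA tensM mul1r mulrA.
rewrite (coassoc_tlift H T); [|by rewrite /T; linear_tac..].
rewrite -[in RHS](comul_counitr H b) (linear_tlift (fun w => (w ⊗ 1 : AA) * _));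
  last by linear_tac.
apply: eq_tlift => p q.
rewrite -(linear_tlift (fun w => (p ⊗ 1 : AA) * Ψ (Δ c) * (1 ⊗ (w * d))));
  last by linear_tac.
by rewrite antipodel untwistE -scalerAl mul1r tensZr -scalerAr tensZl -scalerAl mulrA.
Qed.

(** For y = c ⊗ d the left side is Σ c1 b1 λ(S(b2) S(c2) d b3). The twist brings b3 to the front as
    S²(b3), and S²(b3) S(b2) = S(b2 S(b3)) collapses. *)
Lemma slicer_untwist_comulr b (y : AA) :
  slicer lam (untwist (y * Δ b)) = slicer lam (untwist y) * b.
Proof.
elim/tensor_ind: y => [e u v IHu IHv|c d].
  by rewrite mulrDl -scalerAl !linearP /= IHu IHv mulrDl -scalerAl.
rewrite -{1}[Δ b]tlift_tens.
rewrite (linear_tlift (fun w : AA => slicer lam (untwist (_ * w))));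
  last by linear_tac.
set W := untwist (c ⊗ d).
pose T p q v := slicer lam ((1 ⊗ (S (S v) * S q) : AA) * W) * p.
transitivity (tlift (fun x z => tlift (fun p q => T p q z) (Δ x)) (Δ b)).
  apply: eq_tlift => u v; rewrite tensM untwistE comulM -{1}[Δ u]tlift_tens.
  rewrite (linear_tlift (fun w : AA => slicer lam (Ψ (_ * w) * _)));
    last by linear_tac.
  apply: eq_tlift => p q; rewrite tmapS_mulr.
  have E : (p ⊗ 1) * (1 ⊗ (d * v)) = (1 ⊗ d) * (1 ⊗ v) * (p ⊗ 1) :> AA.
    by rewrite !tensM !mul1r !mulr1.
  rewrite -[X in slicer lam X]mulrA E !mulrA slicer_mulr
    slicer_twist /T /W untwistE !mulrA tensM.
  by rewrite mulr1.
rewrite (coassoc_tlift H T); [|by rewrite /T; linear_tac..].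
rewrite -[in RHS](comul_counitr H b) (linear_tlift (fun w => _ * w));
  last by linear_tac.
apply: eq_tlift => p q.
transitivity (tlift (fun u v => slicer lam ((1 ⊗ S (u * S v) : AA) * W) * p) (Δ q)).
  by apply: eq_tlift => u v; rewrite /T antipodeM.
rewrite -(linear_tlift (fun w => slicer lam ((1 ⊗ S w : AA) * W) * p));
  last by linear_tac.
by rewrite antipoder linearZ /=
  antipode1 tensZr -scalerAl mul1r linearZ /= -scalerAl scalerAr.
Qed.

Lemma slicer_untwist_central y : y \in C2 H -> slicer lam (untwist y) \in ZA A.
Proof.
move=> /C2P yC; apply/ZP => b.
by rewrite -slicer_untwist_comulr -yC untwist_comull slicer_mull.
Qed.

(** Here [slicer lam (untwist y)] is F(y). For y = c ⊗ d, Δ(z) (c ⊗ 1) = Σ Δ(z c1) (1 ⊗ S(c2)), and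
    the integral property of λ gives Σ λ(z c1) λ(S(c2) d). *)
Lemma slicel_comul_mul z (y : AA) :
  lam (slicel lam (Δ z * y)) = lam (z * slicer lam (untwist y)).
Proof.
elim/tensor_ind: y => [e u v IHu IHv|c d].
  by rewrite mulrDr -scalerAr !linearP /= IHu IHv mulrDr -scalerAr !linearP.
have {1}-> : c ⊗ d = (c ⊗ 1) * (1 ⊗ d) :> AA by rewrite tensM mul1r mulr1.
rewrite mulrA slicel_mulr -(comul_antipode H c).
rewrite (linear_tlift (fun w : AA => lam (slicel lam (_ * w) * _))); last first.
  by move=> e u v; rewrite mulrDr -scalerAr linearP /= mulrDl -scalerAl linearP.
rewrite untwistE /tmap
  (linear_tlift (fun w : AA => lam (z * slicer lam (w * _))));
  last first.
  by move=> e u v; rewrite mulrDl -scalerAl linearP /= mulrDr -scalerAr linearP.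
apply: eq_tlift => u v.
rewrite mulrA -comulM slicel_mulr slicel_comul -!scalerAl mul1r linearZ /=.
by rewrite id_lfunE tensM mulr1 slicerE -scalerAr linearZ /=; apply: mulrC.
Qed.

Lemma C2_mul_central w z y :
  w \in ZA A -> z \in ZA A -> y \in C2 H -> (w ⊗ z) * y \in C2 H.
Proof.
move=> Zw Zz /C2P yC; apply/C2P => b.
by rewrite [LHS]mulrA -central_tens // -[LHS]mulrA yC mulrA.
Qed.

Lemma C2_mul_comul z y : z \in ZA A -> y \in C2 H -> Δ z * y \in C2 H.
Proof.
move=> /ZP zC /C2P yC; apply/C2P => b.
by rewrite [LHS]mulrA -comulM -zC comulM -[LHS]mulrA yC mulrA.
Qed.

(** * The braided flip and the vanishing of the pairings *)

Lemma slice_tflip (t : AA) : lam (slicel lam (tflip A A t)) = lam (slicel lam t).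
Proof.
elim/tensor_ind: t => [c x y IHx IHy|x y]; first by rewrite !linearP /= IHx IHy.
by rewrite tflipE !slicelE !linearZ /=; apply: mulrC.
Qed.

(** The twist in both factors moves R to the front as (S² ⊗ S²)(R). This is conjugation of R by g ⊗
    g, so it equals R and cancels R^-1. *)
Lemma slice_conj g (R t : AA) :
  g \is a GRing.unit -> (forall a, S (S a) = g * a * g^-1) ->
  R \is a GRing.unit -> (g ⊗ g) * R = R * (g ⊗ g) ->
  lam (slicel lam (R^-1 * t * R)) = lam (slicel lam t).
Proof.
move=> Ug S2 UR gR.
have twist (s u : AA) : lam (slicel lam (u * s)) =
    lam (slicel lam ((g ⊗ g) * s * (g^-1 ⊗ g^-1) * u)).
  elim/tensor_ind: s => [c x y IHx IHy|x y].
    rewrite mulrDr -scalerAr !linearP /= IHx IHy.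
    by rewrite mulrDr -scalerAr 2!mulrDl -!scalerAl !linearP.
  elim/tensor_ind: u => [c v w IHv IHw|v w].
    by rewrite mulrDl -scalerAl !linearP /= IHv IHw mulrDr -scalerAr !linearP.
  rewrite !tensM -!S2 !slicelE !linearZ /= !integral_antipode2.
  by [].
rewrite twist gR !mulrA -[R * _ * _]mulrA tensM mulrV // tens11 mulr1.
by rewrite mulrV // mul1r.
Qed.

(** R intertwines Δ(b) with its flip, and T(y) commutes with the flipped coproducts. *)
Lemma tflip_C2 R y : quasitriangular H R -> y \in C2 H ->
  R^-1 * tflip A A y * R \in C2 H.
Proof.
move=> [UR flipR _ _] /C2P yC; apply/C2P => b.
have E : R * Δ b = tflip A A (Δ b) * R by rewrite flipR divrK.
have E' : Δ b * R^-1 = R^-1 * tflip A A (Δ b) by rewrite flipR !mulrA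
  mulVr // mul1r.
rewrite !mulrA E' -[RHS]mulrA E !mulrA; congr (_ * R).
by rewrite -!mulrA -!tflipM yC.
Qed.

Lemma slice_radical w z y : w \in ZA A -> z \in ZA A -> y \in C2 H ->
  (forall b, b \in ZA A -> lam (w * b) = 0) ->
  lam (slicel lam ((z ⊗ w) * y)) = 0 /\
  lam (slicel lam ((1 ⊗ w) * Δ z * y)) = 0.
Proof.
move=> Zw Zz Cy Kw; have Z1 : 1 \in ZA A by apply/ZP => b; rewrite mul1r mulr1.
have -> : z ⊗ w = (1 ⊗ w) * (z ⊗ 1) :> AA by rewrite tensM mul1r mulr1.
by split; rewrite -mulrA slicel_mull Kw // slicel_C2_central //
  ?C2_mul_central ?C2_mul_comul.
Qed.

Lemma slice_radical_flip R g w z y : ribbon H R g ->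
  w \in ZA A -> z \in ZA A -> y \in C2 H ->
  (forall b, b \in ZA A -> lam (z * b) = 0) ->
  lam (slicel lam ((z ⊗ w) * y)) = 0 /\
  lam (slicel lam ((1 ⊗ w) * Δ z * y)) = 0.
Proof.
move=> [qR [Ug Dg S2] _ _ _] Zw Zz Cy Kz.
have Z1 : 1 \in ZA A by apply/ZP => b; rewrite mul1r mulr1.
have [UR flipR _ _] := qR.
(* The flip fixes Δ(g) = g ⊗ g, so conjugation by R fixes it too. *)
have gR : (g ⊗ g) * R = R * (g ⊗ g).
  by have := flipR g; rewrite Dg tflipE => {1}->; rewrite divrK.
split.
  (* The flip exchanges z and w; conjugation by R then returns T(y) to [C2], with w ⊗ z pulled out
     since it is central. *)
  rewrite -slice_tflip tflipM tflipE -(slice_conj g R _ Ug S2 UR gR).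
  rewrite mulrA -central_tens // -!mulrA; set y' := R^-1 * _.
  have Cy' : y' \in C2 H by rewrite /y' mulrA tflip_C2.
  by have [] := slice_radical _ _ _ Zz Zw Cy' Kz.
rewrite -mulrA; set y' := Δ z * y.
have -> : (1 ⊗ w) * y' = Δ z * ((1 ⊗ w) * y).
  by rewrite /y' mulrA central_tens // mulrA.
by rewrite slicel_comul_mul Kz // slicer_untwist_central // C2_mul_central.
Qed.

End Integral.

(** * Descent to the quotients *)

Theorem proposition2p4 (k : fieldType) (A : falgType k) (H : hopf A)
    (R : tensor A A) (g Lambda : A) (lam : 'Hom(A, k^o)) :
  ribbon H R g -> unimodular H ->
  left_integral H Lambda -> right_integral H Lambda ->
  right_integral_dual H lam -> lam Lambda = 1 ->
  exists delta : 'Hom(tensor (subvs_of (ZA A)) (subvs_of (ZA A)),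
                      subvs_of (C2Z H)),
    (forall w z : subvs_of (ZA A),
       vsval (delta (w ⊗ z)) =
         vsval z ⊗ vsval w - ((1 : A) ⊗ vsval w) * comul H (vsval z))
    /\ exists delta_hat : 'Hom(tensor (Zhat lam) (Zhat lam), C2Zhat H lam),
         forall t, delta_hat (tmap (qmap (KA lam)) (qmap (KA lam)) t) =
                   qmap (K2Z H lam) (delta t).
Proof.
move=> rib _ intl intr intlam lamL.
have Z1 : 1 \in ZA A by apply/ZP => b; rewrite mul1r mulr1.
pose d (w z : subvs_of (ZA A)) : tensor A A :=
  vsval z ⊗ vsval w - ((1 : A) ⊗ vsval w) * comul H (vsval z).
have dC w z : d w z \in C2Z H.
  rewrite memvB ?mem_C2Z_gen ?subvsP //.
  (* A generator of [C2Z] with c = 1. *)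
  have -> : vsval z ⊗ vsval w = (vsval z ⊗ vsval w) * comul H 1.
    by rewrite comul1 mulr1.
  by rewrite mem_C2Z_gen ?subvsP.
have dl z : linear (d^~ z).
  move=> c x y; rewrite /d linearP /= tensDr tensZr tensDr tensZr
    mulrDl -scalerAl.
  by rewrite opprD addrACA scalerBr.
have dr w : linear (d w).
  move=> c x y; rewrite /d !linearP /= tensDl tensZl mulrDr -scalerAr.
  by rewrite opprD addrACA scalerBr.
pose D w z : subvs_of (C2Z H) := vsproj (C2Z H) (d w z).
pose delta := tlift D.
have DE w z : delta (w ⊗ z) = D w z.
  rewrite /delta tliftE // => [v|v] c x y; first by rewrite /D dl linearP.
  by rewrite /D dr linearP.
have deltaE w z : vsval (delta (w ⊗ z)) = d w z by rewrite DE vsprojK.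
exists delta; split=> //.
have K0 w z : (w \in KA lam) || (z \in KA lam) -> qmap (K2Z H lam) (D w z) = 0.
  move=> K; apply/eqP; rewrite -memv_ker lker_qmap; apply/K2ZP => y Cy.
  rewrite vsprojK // mu_slicel mulrBl linearB /= linearB /=.
  have [-> ->] : lam (slicel lam ((vsval z ⊗ vsval w) * y)) = 0 /\
      lam (slicel lam ((1 ⊗ vsval w) * comul H (vsval z) * y)) = 0.
    case/orP: K => /KP K.
      exact: (slice_radical H Lambda lam intl intr intlam lamL _ _ _ (subvsP w)
        (subvsP z) Cy K).
    exact: (slice_radical_flip H Lambda lam intl intr intlam lamL R g _ _ _ rib
      (subvsP w) (subvsP z) Cy K).
  by rewrite subr0.
(* A linear section of the surjective class map: it picks representatives, correct up to [KA]. *)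
pose s := (qmap (KA lam))^-1%VF.
have sK v : s (qmap (KA lam) v) - v \in KA lam.
  suff : s (qmap (KA lam) v) - v \in lker (qmap (KA lam)) by rewrite lker_qmap.
  rewrite memv_ker linearB /= limg_lfunVK ?subrr //.
  by rewrite limg_qmap memvf.
exists (tlift (fun a b => qmap (K2Z H lam) (D (s a) (s b)))) => t.
elim/tensor_ind: t => [c x y IHx IHy|w z]; first by rewrite !linearP /= IHx IHy.
rewrite tmapE tliftE => [|b|a]; last 2 first.
- by move=> c x y; rewrite linearP /D dl !linearP.
- by move=> c x y; rewrite linearP /D dr !linearP.
set w' := s _; set z' := s _; rewrite DE.
(* Changing one representative at a time leaves two error terms, each with an argument in [KA] and
   so killed by [K0]. *)
have -> : D w' z' = D (w' - w) z' + D w (z' - z) + D w z.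
  rewrite /D -!linearD; congr (vsproj _ _).
  have Bl u v x : d (u - v) x = d u x - d v x.
    by have := dl x (-1) v u; rewrite !scaleN1r ![- _ + _]addrC.
  have Br u v x : d x (u - v) = d x u - d x v.
    by have := dr x (-1) v u; rewrite !scaleN1r ![- _ + _]addrC.
  by rewrite Bl Br -addrA !subrK.
by rewrite !linearD /= K0 ?sK // add0r K0 ?sK ?orbT // add0r.
Qed.
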